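(* Let $\mathcal{T}/\!\sim\; = \{(\alpha,\beta,\gamma)\in(0,\pi)^3 : \alpha+\beta+\gamma=\pi\}$ and let $T:\mathcal{T}/\!\sim\;\to\mathcal{T}/\!\sim$ be the map $$T(\alpha,\beta,\gamma)=\left(\frac{\beta+\gamma}{2},\frac{\alpha+\gamma}{2},\frac{\alpha+\beta}{2}\right).$$ Then for every $\Delta=(\alpha,\beta,\gamma)\in\mathcal{T}/\!\sim$, $$\lim_{n\to\infty}T^n(\Delta)=\left(\frac{\pi}{3},\frac{\pi}{3},\frac{\pi}{3}\right).$$
   Context: A similarity class of non-degenerate planar triangles (every inner angle strictly between $0$ and $\pi$) is identified with the triple $(\alpha,\beta,\gamma)$ of its inner angles; $\mathcal{T}/\!\sim$ is the set of these triples. $T^n$ denotes the $n$-fold composition $T\circ\cdots\circ T$. The limit is taken in $\mathbb{R}^3$. *)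

(* Defs.v *)
From HB Require Import structures.
From mathcomp Require Import all_boot all_order all_algebra.
From mathcomp Require Import all_classical all_reals all_analysis.
From mathcomp Require Import lra.

Set Implicit Arguments.
Unset Strict Implicit.
Unset Printing Implicit Defensive.

Import Order.TTheory GRing.Theory Num.Theory.
Import numFieldNormedType.Exports.

Local Open Scope classical_set_scope.
Local Open Scope ring_scope.

(* Similarity classes of non-degenerate triangles, each identified with its
   (ordered) triple of inner angles.  As a type, [triangle_classes R] is the
   subtype of [R * R * R] carved out by this set. *)
Definition triangle_classes (R : realType) : set (R * R * R) :=
  [set x | let: (a, b, c) := x in
    [/\ 0 < a < pi, 0 < b < pi, 0 < c < pi & a + b + c = pi]].
Arguments triangle_classes R : clear implicits.

Definition half_sums (R : realType) (x : R * R * R) : R * R * R :=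
  let: (a, b, c) := x in ((b + c) / 2, (a + c) / 2, (a + b) / 2).

Lemma half_sums_triangle (R : realType) (x : R * R * R) :
  x \in triangle_classes R -> half_sums x \in triangle_classes R.
Proof.
rewrite !inE; case: x => [[a b] c] /= [].
move=> /andP[a0 ap] /andP[b0 bp] /andP[c0 cp] abc.
by split; [apply/andP; split; lra .. | lra].
Qed.

Definition T (R : realType) (D : triangle_classes R) : triangle_classes R :=
  exist _ (half_sums (\val D)) (half_sums_triangle (valP D)).

(* Main.v *)
Require Import Defs.
From mathcomp Require Import all_boot all_order all_algebra.
From mathcomp Require Import all_classical all_reals all_analysis.
From mathcomp Require Import lra ring.

Import Order.TTheory GRing.Theory Num.Theory.
Import numFieldNormedType.Exports.

Local Open Scope classical_set_scope.
Local Open Scope ring_scope.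

(** Since the angles sum to [pi], half the sum of two of them is
    [(pi - a) / 2], where [a] is the third one.  So [T] acts on each angle
    separately, by the affine contraction with fixed point [pi / 3] and ratio
    [- 1 / 2].  The iterates are therefore explicit ([iter_T]): the deviation
    of each angle from [pi / 3] is multiplied by [(- 1 / 2) ^+ n], which tends
    to [0]. *)

Definition contract {R : realType} (n : nat) (a : R) : R :=
  pi / 3 + (- 2^-1) ^+ n * (a - pi / 3).

Lemma contract0 (R : realType) (a : R) : contract 0 a = a.
Proof. by rewrite /contract expr0 mul1r addrC subrK. Qed.

Lemma contractS (R : realType) (n : nat) (a : R) :
  contract n.+1 a = (pi - contract n a) / 2.
Proof. by rewrite /contract exprS; field. Qed.

Lemma cvg_contract (R : realType) (a : R) :
  (fun n : nat => contract n a) @ \oo --> (pi / 3 : R).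
Proof.
rewrite -[X in _ --> X]addr0; apply: cvgD; first exact: cvg_cst.
rewrite -[X in _ --> X](mul0r (a - pi / 3)); apply: cvgMr_tmp.
by apply: cvg_expr; rewrite normrN ger0_norm; lra.
Qed.

(** The angle sum [pi], which turns half-sums into [(pi - a) / 2], holds for
    every iterate because [T] stays in the set of triangle classes; the
    induction reads it off the membership proof of the [n]-th iterate. *)
Lemma iter_T (R : realType) (D : triangle_classes R) (n : nat) :
  \val (iter n (@T R) D) =
  (contract n (\val D).1.1, contract n (\val D).1.2, contract n (\val D).2).
Proof.
elim: n => [|n IHn]; first by rewrite !contract0 /=; case: (\val D) => [[]].
have := valP (iter n (@T R) D); rewrite inE iterS /= IHn /= => -[_ _ _ sum_pi].
by rewrite !contractS -sum_pi; congr (_ , _, _); field.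
Qed.

Theorem mainTheorem2 (R : realType) (D : triangle_classes R) :
  (fun n : nat => \val (iter n (@T R) D)) @ \oo --> (pi / 3, pi / 3, pi / 3 : R).
Proof.
under eq_fun do rewrite iter_T.
(* The limit filter of a pair is a product filter only up to conversion, so its
   two factors are given by hand. *)
apply: (@cvg_pair _ _ _ _ (nbhs _) (nbhs _)); last exact: cvg_contract.
by apply: (@cvg_pair _ _ _ _ (nbhs _) (nbhs _)); exact: cvg_contract.
Qed.
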